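(* $\mathrm{BIJ}_{cat}$ is an inverse category.
   Context: An inverse category is a category in which for each morphism $g:a\to b$ there is a unique morphism $g^*:b\to a$ with $gg^*g=g$ and $g^*gg^*=g^*$. The category of partial bijections $\mathrm{BIJ}_{cat}$: the objects are all sets. A morphism from $B$ to $A$ is a partial bijection ${}_A^Xf_B^Y$, i.e. a choice of subsets $Y\subseteq B$, $X\subseteq A$ and a bijection $f:Y\to X$. The identity at $A$ is ${}_A^A(\mathrm{id}_A)_A^A$. The composite of ${}_A^Xf_B^Y$ and ${}_B^{X'}g_D^{Y'}$ is the partial bijection from $D$ to $A$ given by the bijection $f|_{Y\cap X'}\circ g|_{g^{-1}(Y\cap X')}$ from $g^{-1}(Y\cap X')\subseteq D$ onto $f(Y\cap X')\subseteq A$. The map $*$ is $({}_A^Xf_B^Y)^*={}_B^Y(f^{-1})_A^X$. *)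

(* Defs.v *)
From mathcomp Require Import all_boot.
From mathcomp Require Import boolp classical_sets.

Set Implicit Arguments.
Unset Strict Implicit.
Unset Printing Implicit Defensive.

Local Open Scope classical_set_scope.

(** Categories, as data together with a predicate stating the axioms.
    [comp f g] is "f after g". *)

Record category_data := CategoryData {
  obj : Type;
  hom : obj -> obj -> Type;
  idm : forall a, hom a a;
  comp : forall a b c (f : hom b c) (g : hom a b), hom a c
}.

Arguments hom {C} a b : rename.
Arguments idm {C} a : rename.
Arguments comp {C a b c} f g : rename.

Definition is_category (C : category_data) : Prop :=
  [/\ forall (a b : obj C) (f : hom a b), comp (idm b) f = f,
      forall (a b : obj C) (f : hom a b), comp f (idm a) = f &
      forall (a b c d : obj C) (f : hom c d) (g : hom b c) (h : hom a b),
        comp f (comp g h) = comp (comp f g) h].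

Definition generalized_inverse (C : category_data) (a b : obj C)
    (g : hom a b) (h : hom b a) : Prop :=
  comp (comp g h) g = g /\ comp (comp h g) h = h.

Definition is_inverse_category (C : category_data) : Prop :=
  is_category C /\
  forall (a b : obj C) (g : hom a b),
    exists! h : hom b a, generalized_inverse g h.

(** [pbij B A] is the type of partial bijections from [B] to [A]. The subsets
    are coerced to the types of their elements, so that [pfun f] is only
    defined on [pdom f]. *)

Record pbij (B A : Type) := PBij {
  pdom : set B;
  pcod : set A;
  pfun : pdom -> pcod;
  pfun_bij : bijective pfun
}.

Definition pbij_id (A : Type) : pbij A A :=
  @PBij A A setT setT id (inv_bij (fun=> erefl)).

Section Star.
Variables (B A : Type) (f : pbij B A).

Lemma pfun_inv_ex :
  exists g : pcod f -> pdom f, cancel (@pfun _ _ f) g /\ cancel g (@pfun _ _ f).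
Proof. by case: (pfun_bij f) => g fK gK; exists g. Qed.

Definition pfun_inv : pcod f -> pdom f := projT1 (cid pfun_inv_ex).

Lemma pfunK : cancel (@pfun _ _ f) pfun_inv.
Proof. by rewrite /pfun_inv; case: cid => g []. Qed.

Lemma pfun_invK : cancel pfun_inv (@pfun _ _ f).
Proof. by rewrite /pfun_inv; case: cid => g []. Qed.

Definition pbij_star : pbij A B :=
  @PBij A B (pcod f) (pdom f) pfun_inv (Bijective pfun_invK pfunK).

End Star.

Section Comp.
Variables (D B A : Type) (f : pbij B A) (g : pbij D B).

(** With Y = [pdom f] and X' = [pcod g], these are the subsets g^-1(Y `&` X')
    of [D] and f(Y `&` X') of [A]. *)
Definition comp_dom : set D :=
  [set val d | d in [set d : pdom g | (pdom f `&` pcod g) (val (pfun d))]].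
Definition comp_cod : set A :=
  [set val (pfun y) | y in [set y : pdom f | (pdom f `&` pcod g) (val y)]].

Lemma comp_dom_pdom (z : comp_dom) : val z \in pdom g.
Proof. by case: z => z /= /set_mem[d _ <-]; exact: (valP d). Qed.

Definition comp_in (z : comp_dom) : pdom g := SigSub (comp_dom_pdom z).

Lemma comp_in_pdom (z : comp_dom) : val (pfun (comp_in z)) \in pdom f.
Proof.
apply: mem_set; have [d [fd _] dz] := set_mem (valP z).
by rewrite (_ : comp_in z = d) //; exact: val_inj.
Qed.

Definition comp_mid (z : comp_dom) : pdom f := SigSub (comp_in_pdom z).

Lemma comp_mid_cod (z : comp_dom) : val (pfun (comp_mid z)) \in comp_cod.
Proof.
apply: mem_set; exists (comp_mid z) => //=; split; apply: set_mem.
  exact: comp_in_pdom.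
exact: valP.
Qed.

Definition comp_fun (z : comp_dom) : comp_cod := SigSub (comp_mid_cod z).

End Comp.

Lemma comp_fun_inj (D B A : Type) (f : pbij B A) (g : pbij D B) :
  injective (@comp_fun D B A f g).
Proof.
move=> z w /(congr1 val)/= /val_inj /(bij_inj (pfun_bij f)) /(congr1 val)/=.
move=> /val_inj /(bij_inj (pfun_bij g)) /(congr1 val)/=; exact: val_inj.
Qed.

Lemma comp_fun_surj (D B A : Type) (f : pbij B A) (g : pbij D B)
    (x : comp_cod f g) : exists z, comp_fun z = x.
Proof.
have [y [fy gy] yx] := set_mem (valP x).
pose d := pfun_inv (SigSub (mem_set gy) : pcod g).
have dE : pfun d = SigSub (mem_set gy) := pfun_invK _.
have dP : val d \in comp_dom f g.
  by apply: mem_set; exists d => //=; rewrite dE.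
exists (SigSub dP); apply: val_inj => /=; rewrite -yx.
congr (val (pfun _)); apply: val_inj => /=.
by rewrite (_ : comp_in _ = d) ?dE //; exact: val_inj.
Qed.

Lemma comp_fun_bij (D B A : Type) (f : pbij B A) (g : pbij D B) :
  bijective (@comp_fun D B A f g).
Proof.
have [h hK] := choice (@comp_fun_surj D B A f g).
by exists h => // z; apply: comp_fun_inj; rewrite hK.
Qed.

Definition pbij_comp (D B A : Type) (f : pbij B A) (g : pbij D B) : pbij D A :=
  PBij (@comp_fun_bij D B A f g).

(** The objects are all types of a fixed universe, in the role of sets. *)
Definition BIJ_cat : category_data :=
  @CategoryData Type pbij pbij_id
    (fun D B A (f : pbij B A) (g : pbij D B) => pbij_comp f g).

(* Main.v *)
From mathcomp Require Import all_boot.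
From mathcomp Require Import boolp classical_sets.
Require Import Defs.

Set Implicit Arguments.
Unset Strict Implicit.
Unset Printing Implicit Defensive.

(** A partial bijection is determined by its graph ([pbij_ext]), a relation that
    is single-valued in both directions ([graph_fun], [graph_inj]). On graphs,
    composition is composition of relations, the identity is equality and the
    star is the converse relation ([graph_comp], [graph_id], [graph_star]). The
    category axioms are therefore those of relations, which frees the proofs
    from the subsets, and the proofs of membership in them, that the composite
    of partial bijections carries.

    For a relation [f] that is single-valued in both directions, a path
    x - y' - x' - y alternating between [f] and its converse has x = x' and
    y = y', so that f f* f = f and f* f f* = f*. For uniqueness, let [h] be a
    generalized inverse of [f]. If h relates y to x, then h = h f h gives
    x' and y' with h y x', f x' y' and h y' x. As h is single-valued in both
    directions, x' = x and y' = y, so f x y: thus h is contained in f*. The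
    definition of a generalized inverse is symmetric in f and h, so f is also
    contained in h*, and h = f*. *)

Definition graph (B A : Type) (f : pbij B A) (x : B) (y : A) : Prop :=
  exists2 d : pdom f, val d = x & val (pfun d) = y.

Lemma graph_fun (B A : Type) (f : pbij B A) (x : B) (y y' : A) :
  graph f x y -> graph f x y' -> y = y'.
Proof. by move=> [d dx <-] [e ex <-]; rewrite (val_inj (etrans dx (esym ex))). Qed.

Lemma graph_inj (B A : Type) (f : pbij B A) (x x' : B) (y : A) :
  graph f x y -> graph f x' y -> x = x'.
Proof.
move=> [d <- dy] [e <- ey].
by rewrite (bij_inj (pfun_bij f) (val_inj (etrans dy (esym ey)))).
Qed.

Lemma pdom_graph (B A : Type) (f : pbij B A) :
  pdom f = [set x | exists y, graph f x y]%classic.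
Proof.
apply/seteqP; split=> x /=.
  by move=> fx; exists (val (pfun (SigSub (mem_set fx) : pdom f))), (SigSub (mem_set fx)).
by move=> [_ [d <- _]]; exact: set_mem (valP d).
Qed.

Lemma pcod_graph (B A : Type) (f : pbij B A) :
  pcod f = [set y | exists x, graph f x y]%classic.
Proof.
apply/seteqP; split=> y /=.
  move=> fy; exists (val (pfun_inv (SigSub (mem_set fy) : pcod f))).
  by exists (pfun_inv (SigSub (mem_set fy))); rewrite ?pfun_invK.
by move=> [_ [d _ <-]]; exact: set_mem (valP (pfun d)).
Qed.

(** The domain and the codomain can be read off the graph; once they are
    identified, so are the types of the two functions, and the functions agree
    because the graph is single-valued. *)
Lemma pbij_ext (B A : Type) (f g : pbij B A) :
  (forall x y, graph f x y <-> graph g x y) -> f = g.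
Proof.
move=> fg; have {fg} gfg : graph f = graph g.
  by apply/funext => x; apply/funext => y; apply/propext.
have eqd : pdom f = pdom g by rewrite !pdom_graph gfg.
have eqc : pcod f = pcod g by rewrite !pcod_graph gfg.
case: f g => [df cf f bf] [dg cg g bg] /= in gfg eqd eqc *.
subst dg cg; have eqf : f = g.
  apply/funext => d; apply: val_inj.
  have gd : graph (PBij bf) (val d) (val (f d)) by exists d.
  by apply: graph_fun gd _; rewrite gfg; exists d.
by subst g; congr PBij; exact: Prop_irrelevance.
Qed.

Lemma graph_id (A : Type) (x y : A) : graph (pbij_id A) x y <-> x = y.
Proof.
split; first by move=> [d <- <-].
by move=> <-; exists (SigSub (mem_set (I : setT x))).
Qed.

Lemma graph_star (B A : Type) (f : pbij B A) (x : B) (y : A) :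
  graph (pbij_star f) y x <-> graph f x y.
Proof.
split; first by move=> [e <- <-]; exists (pfun_inv e); rewrite ?pfun_invK.
by move=> [d <- <-]; exists (pfun d); rewrite //= pfunK.
Qed.

Lemma graph_comp (D B A : Type) (f : pbij B A) (g : pbij D B) (x : D) (z : A) :
  graph (pbij_comp f g) x z <-> exists2 y, graph g x y & graph f y z.
Proof.
split=> [[d <- <-]|[_ [d <- <-] [e ed <-]]].
  by exists (val (pfun (comp_in d))); [exists (comp_in d)|exists (comp_mid d)].
have dP : val d \in comp_dom f g.
  apply: mem_set; exists d => //=; split; last exact: set_mem (valP _).
  by rewrite -ed; exact: set_mem (valP e).
exists (SigSub dP) => //=; congr (val (pfun _)); apply: val_inj; rewrite /= ed.
by congr (val (pfun _)); exact: val_inj.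
Qed.

Lemma BIJ_is_category : is_category BIJ_cat.
Proof.
split=> [a b f|a b f|a b c d f g h]; apply: pbij_ext => x y; split.
- by move=> /graph_comp[z fxz /graph_id <-].
- by move=> fxy; apply/graph_comp; exists y => //; apply/graph_id.
- by move=> /graph_comp[z /graph_id <-].
- by move=> fxy; apply/graph_comp; exists x => //; apply/graph_id.
- move=> /graph_comp[z /graph_comp[w hw gw] fz].
  by apply/graph_comp; exists w => //; apply/graph_comp; exists z.
- move=> /graph_comp[w hw /graph_comp[z gw fz]].
  by apply/graph_comp; exists z => //; apply/graph_comp; exists w.
Qed.

Lemma graph_comp3 (D C B A : Type) (f : pbij B A) (g : pbij C B) (h : pbij D C)
    (x : D) (y : A) :
  graph (pbij_comp (pbij_comp f g) h) x y <->
  exists u v, [/\ graph h x u, graph g u v & graph f v y].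
Proof.
split; first by move=> /graph_comp[u hu /graph_comp[v gv fv]]; exists u, v.
move=> [u [v [hu gv fv]]]; apply/graph_comp; exists u => //.
by apply/graph_comp; exists v.
Qed.

Lemma star_generalized_inverse (B A : obj BIJ_cat) (f : hom B A) :
  generalized_inverse f (pbij_star f : hom A B).
Proof.
split; apply: pbij_ext => x y; rewrite graph_comp3; split.
- move=> [u [v [fxu /graph_star fvu fvy]]].
  by rewrite (graph_inj fxu fvu).
- by move=> fxy; exists y, x; split=> //; apply/graph_star.
- move=> [u [v [/graph_star fux fuv /graph_star fyv]]].
  by apply/graph_star; rewrite (graph_fun fux fuv).
- by move=> sxy; exists y, x; split=> //; apply/graph_star.
Qed.

(** Writing [h] as [h f h] splits the step from [y] to [x] into three, and the
    two outer ones, each sharing an end with it, force the middle one to be the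
    reverse of it. *)
Lemma graph_generalized_inverse (B A : obj BIJ_cat) (f : hom B A) (h : hom A B)
    (x : B) (y : A) :
  generalized_inverse f h -> graph h y x -> graph f x y.
Proof.
move=> [_ hfh] hyx; move: (hyx); rewrite -{1}hfh.
move=> /graph_comp3[x' [y' [hyx' fx'y' hy'x]]].
by rewrite (graph_fun hyx hyx') (graph_inj hyx hy'x).
Qed.

Lemma generalized_inverse_unique (B A : obj BIJ_cat) (f : hom B A)
    (h : hom A B) :
  generalized_inverse f h -> pbij_star f = h.
Proof.
move=> fh; have hf : generalized_inverse h f by case: fh.
apply: pbij_ext => y x; rewrite graph_star.
by split; exact: graph_generalized_inverse.
Qed.

Theorem proposition13 :
  is_inverse_category BIJ_cat /\
  (forall (B A : obj BIJ_cat) (f : hom B A),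
     generalized_inverse f (pbij_star f : hom A B)).
Proof.
split; last exact: star_generalized_inverse.
split; first exact: BIJ_is_category.
move=> B A f; exists (pbij_star f).
by split; [exact: star_generalized_inverse|exact: generalized_inverse_unique].
Qed.
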